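(* If $D$ is a $\%$-avoiding diagram that is not northwest, then $\operatorname{ch}(\mathcal{S}^\flat_D)\neq\mathfrak{K}_D$.
   Context: A diagram is a finite set of cells $(i,j)\in\mathbb{Z}_{>0}\times\mathbb{Z}_{>0}$ ($i$ row, $j$ column), rows numbered top to bottom. $D$ is northwest if whenever $(j,k),(i,l)\in D$ with $i<j$, $k<l$, then $(i,k)\in D$. $D$ is $\%$-avoiding if whenever $(j,k),(i,l)\in D$ with $i<j$, $k<l$, then $(i,k)\in D$ or $(j,l)\in D$. A Kohnert move selects the rightmost cell of some row and moves it up (toward row 1) within its column to the first empty position above it, jumping over occupied positions, if one exists; $\mathrm{KD}(D)$ is the set of diagrams reachable from $D$ by sequences of Kohnert moves (including $D$). $\mathbf{wt}(T)$ is the weak composition whose $i$th part is the number of cells in row $i$; $\mathfrak{K}_D=\sum_{T\in\mathrm{KD}(D)}x^{\mathbf{wt}(T)}$. Flagged Schur module: fix $n\ge$ the largest row index of a cell of $D$. With indeterminates $z_{i,j}$, $GL_n$ acts on $\mathbb{C}[z_{i,j}]$ by algebra automorphisms $A\cdot z_{k,l}=\sum_{i\le n}A_{i,k}z_{i,l}$ ($k\le n$), $z_{k,l}$ fixed for $k>n$. For arrays $\mathbf{a},\mathbf{b}\in\mathbb{N}^m$, $(\mathbf{a}\mid\mathbf{b})=\det(z_{a_p,b_q})$. For a filling $T:D\to\{1,\dots,n\}$, $\Delta_T=\prod_j(T^{(j)}\mid D^{(j)})$ where $T^{(j)}$ lists the values of $T$ in column $j$ and $D^{(j)}$ the row indices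 of the cells of $D$ in column $j$ (both ordered by row). $\mathcal{S}_D=\mathrm{span}_\mathbb{C}\{\Delta_T\}$; $I=\langle z_{i,j}:i>j\rangle$; $\mathcal{S}^\flat_D=\mathcal{S}_D/(\mathcal{S}_D\cap I)$ as a module over upper triangular matrices, spanned by images of $\Delta_T$ for flagged $T$ (value at each cell of row $i$ at most $i$). $\operatorname{ch}(\mathcal{S}^\flat_D)$ is the trace of $\mathrm{diag}(x_1,\dots,x_n)$ acting on it. *)

(* Defs.v *)
From Stdlib Require Import ClassicalEpsilon.
From mathcomp Require Import all_boot all_order all_algebra.
From mathcomp Require Import reals complex mpoly.

Set Implicit Arguments.
Unset Strict Implicit.
Unset Printing Implicit Defensive.

Import Order.TTheory GRing.Theory Num.Theory.
Local Open Scope ring_scope.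

(** * Diagrams

  A diagram is given together with a box [n] x [m] containing it (n bounds the
  row indices, m the column indices; both are arbitrary), so it is a finite
  set of pairs (row, column).  Indices are 0-based: the ordinal i stands for
  the row or column i + 1, and row 0 is the top row.  The bound n is also the
  n of GL_n below. *)

Notation diagram n m := {set 'I_n * 'I_m}.

Section Diagrams.
Variables n m : nat.
Implicit Types D E T : diagram n m.

Definition northwest D : Prop :=
  forall (i j : 'I_n) (k l : 'I_m), (i < j)%N -> (k < l)%N ->
    (j, k) \in D -> (i, l) \in D -> (i, k) \in D.

Definition percent_avoiding D : Prop :=
  forall (i j : 'I_n) (k l : 'I_m), (i < j)%N -> (k < l)%N ->
    (j, k) \in D -> (i, l) \in D -> (i, k) \in D \/ (j, l) \in D.

(** [(r, c)] is the rightmost cell of row [r], and [(r', c)] is the first empty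
    position above it. *)
Definition kohnert_move : rel (diagram n m) := fun D E =>
  [exists r : 'I_n, exists c : 'I_m, exists r' : 'I_n,
    [&& (r, c) \in D,
        [forall c' : 'I_m, (c < c')%N ==> ((r, c') \notin D)],
        (r' < r)%N,
        (r', c) \notin D,
        [forall s : 'I_n, (r' < s < r)%N ==> ((s, c) \in D)]
      & E == (r', c) |: (D :\ (r, c))]].

(** Moves go up within a column, hence never leave the box. *)
Definition KD D : {set diagram n m} := [set T | connect kohnert_move D T].

Definition wt T : 'X_{1..n} :=
  [multinom #|[set c : 'I_m | (r, c) \in T]| | r < n].

Definition kohnert_poly (F : nzRingType) D : {mpoly F[n]} :=
  \sum_(T in KD D) 'X_[wt T].

End Diagrams.

(** * Trace of an operator induced on a quotient *)

Section QuotientTrace.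
Variables (F : fieldType) (V : lmodType F).
Implicit Types (S W : V -> Prop) (g : V -> V).

(** The classes of the [b i] form a basis of S / W. *)
Definition quot_basis S W k (b : 'I_k -> V) : Prop :=
  [/\ forall i, S (b i),
      forall v, S v -> exists c : 'I_k -> F, W (v - \sum_i c i *: b i)
    & forall c : 'I_k -> F, W (\sum_i c i *: b i) -> forall i, c i = 0].

(** [t] is the trace of the endomorphism of S / W induced by [g], computed in
    some basis; column [i] of [M] holds the coordinates of the class of
    [g (b i)].  See [is_quot_trace_uniq] for independence of the basis. *)
Definition is_quot_trace S W g (t : F) : Prop :=
  exists (k : nat) (b : 'I_k -> V) (M : 'M[F]_k),
    [/\ quot_basis S W b,
        forall i, W (g (b i) - \sum_j M j i *: b j)
      & t = \tr M].

End QuotientTrace.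

(** * Flagged Schur modules *)

Section FlaggedSchur.
Variables (F : fieldType) (n m : nat).

(** Only z_(i, j) with i, j <= n occur in the Delta_T, so the polynomial ring
    is taken in these n * n indeterminates. *)
Local Notation zpoly := {mpoly F[n * n]}.

Definition zvar (i j : 'I_n) : zpoly := 'X_(mxvec_index i j).

(** The algebra endomorphism with A . z_(k, l) = \sum_i A_(i, k) z_(i, l). *)
Definition gl_act (A : 'M[F]_n) (p : zpoly) : zpoly :=
  p \mPo [tuple mxvec (\matrix_(k, l) \sum_i A i k *: zvar i l) 0 t
         | t < n * n].

Definition zminor k (a b : 'I_k -> 'I_n) : zpoly :=
  \det (\matrix_(p, q) zvar (a p) (b q)).

Section Diagram.
Variable D : diagram n m.

Definition col_rows (j : 'I_m) : {set 'I_n} := [set i | (i, j) \in D].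

(** [enum_val] enumerates the rows of a column in increasing order.  A filling
    is defined on the whole box, but only its values on D matter. *)
Definition Delta (T : {ffun 'I_n * 'I_m -> 'I_n}) : zpoly :=
  \prod_(j < m)
    zminor (fun p : 'I_#|col_rows j| => T (enum_val p, j))
           (fun q : 'I_#|col_rows j| => enum_val q).

Definition schur_module (p : zpoly) : Prop :=
  exists c : {ffun 'I_n * 'I_m -> 'I_n} -> F, p = \sum_T c T *: Delta T.

Definition lower_ideal (p : zpoly) : Prop :=
  exists q : 'I_n -> 'I_n -> zpoly,
    p = \sum_(i < n) \sum_(j < n | (j < i)%N) q i j * zvar i j.

Definition is_flagged_char (ch : {mpoly F[n]}) : Prop :=
  forall x : 'I_n -> F, (forall i, x i != 0) ->
    is_quot_trace schur_module (fun p => schur_module p /\ lower_ideal p)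
      (gl_act (diag_mx (\row_i x i))) ch.@[x].

(** The character of S_D / (S_D :&: I), as a polynomial in x_1, ..., x_n.
    It satisfies [is_flagged_char] by [flagged_charP], and is the only
    polynomial to do so by [is_flagged_char_uniq]. *)
Definition flagged_char : {mpoly F[n]} :=
  epsilon (inhabits 0) is_flagged_char.

End Diagram.
End FlaggedSchur.

(** * Well-definedness of the character *)

Section QuotientTraceTheory.
Variables (F : fieldType) (V : lmodType F) (S W : V -> Prop).
Hypothesis W_lin : forall a u v, W u -> W v -> W (a *: u + v).
Hypothesis W0 : W 0.

Let WD u v : W u -> W v -> W (u + v).
Proof. by move=> Wu Wv; rewrite -[u]scale1r; apply: W_lin. Qed.

Let WZ a u : W u -> W (a *: u).
Proof. by move=> Wu; rewrite -[_ *: _]addr0; apply: W_lin. Qed.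

Let WN u : W u -> W (- u).
Proof. by rewrite -scaleN1r; apply: WZ. Qed.

Let WB u v : W u -> W v -> W (u - v).
Proof. by move=> Wu /WN; apply: WD. Qed.

Let Wsum (I : finType) (f : I -> V) : (forall i, W (f i)) -> W (\sum_i f i).
Proof. by move=> Wf; elim/big_ind: _. Qed.

Let W_trans u v w : W (u - v) -> W (v - w) -> W (u - w).
Proof. by move=> Wuv /(WD Wuv); rewrite addrA subrK. Qed.

Let W_sym u v : W (u - v) -> W (v - u).
Proof. by move/WN; rewrite opprB. Qed.

Let comb k (b : 'I_k -> V) (c : 'I_k -> F) := \sum_i c i *: b i.

Let comb_inj k (b : 'I_k -> V) c d : quot_basis S W b ->
  W (comb b c - comb b d) -> forall i, c i = d i.
Proof.
case=> _ _ b_free Wcd i; apply/subr0_eq; apply: (b_free (fun i => c i - d i)).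
rewrite (eq_bigr (fun i => c i *: b i - d i *: b i)) ?sumrB // => j _.
by rewrite scalerBl.
Qed.

(** Substituting u_i = comb b (P _ i) modulo W in a linear combination. *)
Let comb_subst k l (u : 'I_k -> V) (b : 'I_l -> V) (P : 'M[F]_(l, k)) c :
  (forall i, W (u i - comb b (P^~ i))) ->
  W (\sum_i c i *: u i - comb b (fun j => \sum_i P j i * c i)).
Proof.
move=> WuP; have ->: comb b (fun j => \sum_i P j i * c i)
    = \sum_i c i *: comb b (P^~ i).
  rewrite /comb (eq_bigr (fun j => \sum_i (P j i * c i) *: b j)) => [|j _].
    rewrite exchange_big; apply: eq_bigr => i _; rewrite scaler_sumr.
    by apply: eq_bigr => j _; rewrite scalerA mulrC.
  by rewrite scaler_suml.
by rewrite -sumrB; apply: Wsum => i; rewrite -scalerBr; apply: WZ.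
Qed.

Let coords k l (u : 'I_k -> V) (b : 'I_l -> V) :
    quot_basis S W b -> (forall i, S (u i)) ->
  exists P : 'M[F]_(l, k), forall i, W (u i - comb b (P^~ i)).
Proof.
case=> _ b_span _ Su.
have cP i := constructive_indefinite_description _ (b_span _ (Su i)).
exists (\matrix_(j, i) sval (cP i) j) => i.
rewrite /comb (eq_bigr (fun j => sval (cP i) j *: b j)) => [|j _].
  exact: (svalP (cP i)).
by rewrite mxE.
Qed.

Let change_basis k l (b : 'I_k -> V) (b' : 'I_l -> V) (P : 'M[F]_(k, l))
    (Q : 'M[F]_(l, k)) :
    quot_basis S W b -> (forall i, W (b' i - comb b (P^~ i))) ->
    (forall i, W (b i - comb b' (Q^~ i))) ->
  P *m Q = 1%:M.
Proof.
move=> Bb WP WQ; apply/matrixP => i j; rewrite !mxE.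
apply: (@comb_inj _ _ (fun i => \sum_j0 P i j0 * Q j0 j)
          (fun i => (i == j)%:R) Bb).
apply: (@W_trans _ (b j)); last first.
  rewrite /comb (bigD1 j) //= eqxx scale1r big1 ?addr0 ?subrr // => i' /negPf->.
  by rewrite scale0r.
by apply/W_sym/(W_trans (WQ j)); apply: comb_subst.
Qed.

Lemma is_quot_trace_uniq (g : V -> V) (t t' : F) :
    (forall a u v, g (a *: u + v) = a *: g u + g v) ->
    (forall u, W u -> W (g u)) ->
  is_quot_trace S W g t -> is_quot_trace S W g t' -> t = t'.
Proof.
move=> g_lin gW [k [b [M [Bb WM ->]]]] [l [b' [M' [Bb' WM' ->]]]].
have g0 : g 0 = 0.
  by have := g_lin 1 0 0; rewrite !scale1r addr0 => /(congr1 (+%R^~ (- g 0)));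
     rewrite addrK subrr.
have gZ a u : g (a *: u) = a *: g u by rewrite -[a *: u]addr0 g_lin g0 addr0.
have gD u v : g (u + v) = g u + g v by rewrite -[u]scale1r g_lin !scale1r.
have gB u v : g (u - v) = g u - g v by rewrite gD -scaleN1r gZ scaleN1r.
have g_comb p (u : 'I_p -> V) c : g (comb u c) = \sum_i c i *: g (u i).
  rewrite /comb; apply: (big_rec2 (fun y z => g y = z)) => // i z y _ <-.
  by rewrite g_lin.
have [P WP] := coords Bb (let: And3 Sb' _ _ := Bb' in Sb').
have [Q WQ] := coords Bb' (let: And3 Sb _ _ := Bb in Sb).
have PQ1 := change_basis Bb WP WQ; have QP1 := change_basis Bb' WQ WP.
have MPPM : M *m P = P *m M'.
  apply/matrixP => i j; rewrite !mxE.
  apply: (@comb_inj _ _ (fun i => \sum_h M i h * P h j)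
            (fun i => \sum_h P i h * M' h j) Bb).
  apply: (@W_trans _ (g (b' j))).
    apply/W_sym/(@W_trans _ (g (comb b (P^~ j)))).
      by rewrite -gB; apply: gW.
    by rewrite g_comb; apply: comb_subst.
  by apply: W_trans (WM' j) _; apply: comb_subst.
by rewrite -[M]mulmx1 -PQ1 mulmxA MPPM mxtrace_mulC mulmxA QP1 mul1mx.
Qed.

(** A spanning family contains a basis of the quotient. *)
Lemma quot_basis_exists (I : finType) (v : I -> V) :
    (forall u, S u <-> exists c : I -> F, u = \sum_i c i *: v i) ->
  exists A : {set I}, quot_basis S W (fun i : 'I_#|A| => v (enum_val i)).
Proof.
move=> S_span.
pose freeP (A : {set I}) := forall c : I -> F,
  W (\sum_(i in A) c i *: v i) -> forall i, i \in A -> c i = 0.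
pose free A : bool := excluded_middle_informative (freeP A).
have free_ok A : reflect (freeP A) (free A).
  by rewrite /free; case: excluded_middle_informative => ?; constructor.
have free0 : free set0 by apply/free_ok => c _ i; rewrite inE.
have [A /maxsetP[/free_ok freeA maxA] _] := maxset_exists free0.
have Sv i : S (v i).
  apply/S_span; exists (fun j => (j == i)%:R).
  rewrite (bigD1 i) //= eqxx scale1r big1 ?addr0 // => j /negPf->.
  by rewrite scale0r.
have vA i : exists c : I -> F, W (v i - \sum_(j in A) c j *: v j).
  have [Ai | A'i] := boolP (i \in A).
    exists (fun j => (j == i)%:R); rewrite (bigD1 i) //= eqxx scale1r big1.
      by rewrite addr0 subrr.
    by move=> j /andP[_ /negPf->]; rewrite scale0r.
  have /free_ok nfree : ~~ free (i |: A).
    apply/negP => fiA; have := maxA _ fiA (subsetUr _ _) => /setP/(_ i).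
    by rewrite !inE eqxx (negPf A'i).
  have [c nc] := not_all_ex_not _ _ nfree.
  have [Wc nc0] := imply_to_and _ _ nc.
  have ci0 : c i != 0.
    apply/eqP => ci0; apply: nc0 => j; rewrite in_setU1 => /predU1P[-> //|Aj].
    by apply: (freeA c) => //; rewrite big_setU1 //= ci0 scale0r add0r in Wc.
  exists (fun j => - ((c i)^-1 * c j)).
  rewrite big_setU1 //= in Wc; move/(WZ (c i)^-1): Wc.
  rewrite scalerDr scalerA mulVf // scale1r scaler_sumr -sumrN.
  congr (W (_ + _)); apply: eq_bigr => j _.
  by rewrite scalerA scaleNr opprK.
exists A; split=> [i|u /S_span[c ->]|c Wc i]; first exact: Sv.
  have dP i := constructive_indefinite_description _ (vA i).
  exists (fun k => \sum_i c i * sval (dP i) (enum_val k)).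
  have <- := big_enum_val (I := I)
    (fun j => (\sum_i c i * sval (dP i) j) *: v j) (A := mem A).
  have -> : \sum_(j in A) (\sum_i c i * sval (dP i) j) *: v j
      = \sum_i c i *: \sum_(j in A) sval (dP i) j *: v j.
    under [RHS]eq_bigr do rewrite scaler_sumr.
    rewrite [RHS]exchange_big; apply: eq_bigr => j _; rewrite scaler_suml.
    by apply: eq_bigr => i _; rewrite scalerA.
  rewrite -sumrB; apply: Wsum => i; rewrite -scalerBr; apply: WZ.
  exact: (svalP (dP i)).
pose c' j := if j \in A =P true is ReflectT Aj then c (enum_rank_in Aj j) else 0.
have c'E k : c' (enum_val k) = c k.
  rewrite /c'; case: eqP => [Aj|]; last by rewrite enum_valP.
  by rewrite enum_valK_in.
rewrite -c'E; apply: (freeA c'); last exact: enum_valP.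
by rewrite big_enum_val /=; under eq_bigr do rewrite c'E.
Qed.

End QuotientTraceTheory.

Section TorusVanishing.

Lemma torus_mpoly_eq (F : numFieldType) n (p q : {mpoly F[n]}) :
  (forall x : 'I_n -> F, (forall i, x i != 0) -> p.@[x] = q.@[x]) -> p = q.
Proof.
move=> epq.
have key (s : seq 'X_{1..n}) : uniq s -> forall c : 'X_{1..n} -> F,
    (forall x : 'I_n -> F, (forall i, x i != 0) ->
      \sum_(m <- s) c m * \prod_i x i ^+ m i = 0) ->
    forall m, m \in s -> c m = 0.
  elim: s => // m0 s IHs /= /andP[m0s /IHs{}IHs] c c0.
  have cs m : m \in s -> c m = 0.
    move=> ms; have [i mi]: exists i, m i != m0 i.
      apply/existsP; apply: contraNT m0s; rewrite negb_exists => /forallP em.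
      by have <- : m = m0 by apply/mnmP => i; apply/eqP; have /negPn := em i.
    pose c' m := c m * (2 ^+ m i - 2 ^+ m0 i).
    have c'0 : c' m = 0.
      apply: IHs ms => x x0.
      pose y (j : 'I_n) := if j == i then 2 * x j else x j.
      have y0 j : y j != 0.
        by rewrite /y; case: ifP => // _; apply: mulf_neq0; rewrite ?pnatr_eq0.
      have yE (m' : 'X_{1..n}) :
          \prod_j y j ^+ m' j = 2 ^+ m' i * \prod_j x j ^+ m' j.
        rewrite (bigD1 i) //= [in RHS](bigD1 i) //= mulrA /y eqxx exprMn.
        by congr (_ * _); apply: eq_bigr => j /negPf->.
      have : \sum_(m' <- m0 :: s) c m' * \prod_j y j ^+ m' j
          - 2 ^+ m0 i * \sum_(m' <- m0 :: s) c m' * \prod_j x j ^+ m' j = 0.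
        by rewrite !c0 // mulr0 subr0.
      rewrite mulr_sumr -sumrB big_cons yE mulrCA subrr add0r => h.
      apply: etrans h; apply: eq_bigr => m' _; rewrite yE /c' mulrBr mulrBl.
      by rewrite [2 ^+ m0 i * _]mulrCA !mulrA.
    move/eqP: c'0; rewrite /c' mulf_eq0 => /orP[/eqP //|].
    rewrite subr_eq0 (inj_eq (ieexprIn _ _)) ?(negPf mi) ?ltr0n //.
    by rewrite -[1]/(1%:R) eqr_nat.
  move=> m; rewrite inE => /predU1P[->|]; last exact: cs.
  have := c0 (fun=> 1) (fun=> oner_neq0 _).
  rewrite big_cons [X in _ + X]big1_seq => [|m' /andP[_ ms]].
    by rewrite addr0 big1 ?mulr1 // => i _; rewrite expr1n.
  by rewrite cs ?mul0r.
apply/subr0_eq/mpolyP => m; rewrite mcoeff0.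
have [ms | /memN_msupp_eq0 //] := boolP (m \in msupp (p - q)).
apply: (key _ (msupp_uniq (p - q)) (fun m => (p - q)@_m)) ms => x x0.
by rewrite -mevalE mevalB epq ?subrr.
Qed.

End TorusVanishing.

Section CharacterTheory.
Variables (F : fieldType) (n m : nat) (D : diagram n m).

Let act (x : 'I_n -> F) := gl_act (diag_mx (\row_i x i)).

Let Wmod (p : {mpoly F[n * n]}) := schur_module D p /\ lower_ideal p.

Let Wmod0 : Wmod 0.
Proof.
split; first by exists (fun=> 0); rewrite big1 // => T _; rewrite scale0r.
exists (fun _ _ => 0); rewrite big1 // => i _.
by rewrite big1 // => j _; rewrite mul0r.
Qed.

Let Wmod_lin a u v : Wmod u -> Wmod v -> Wmod (a *: u + v).
Proof.
move=> [[c uE] [q qE]] [[d vE] [r rE]]; split.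
  exists (fun T => a * c T + d T); rewrite uE vE scaler_sumr -big_split.
  by apply: eq_bigr => T _ /=; rewrite scalerDl scalerA.
exists (fun i j => a *: q i j + r i j).
rewrite [in LHS]qE [in LHS]rE scaler_sumr -big_split; apply: eq_bigr => i _ /=.
rewrite scaler_sumr -big_split; apply: eq_bigr => j _ /=.
by rewrite mulrDl scalerAl.
Qed.

Let act_lin x a u v : act x (a *: u + v) = a *: act x u + act x v.
Proof. by rewrite /act /gl_act raddfD /= comp_mpolyZ. Qed.

Let act_zvar x k l : act x (zvar F k l) = x k *: zvar F k l.
Proof.
rewrite /act /gl_act /zvar comp_mpolyXU -tnth_nth tnth_mktuple mxvecE mxE.
rewrite (bigD1 k) //= big1 ?addr0 => [|i /negPf ik]; rewrite !mxE.
  by rewrite eqxx.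
by rewrite ik scale0r.
Qed.

Let weight (T : {ffun 'I_n * 'I_m -> 'I_n}) : {mpoly F[n]} :=
  \prod_(j < m) \prod_(p < #|col_rows D j|) 'X_(T (enum_val p, j)).

Let act_Delta x T : act x (Delta F D T) = (weight T).@[x] *: Delta F D T.
Proof.
rewrite /weight rmorph_prod /Delta /act /gl_act rmorph_prod -/(act x).
rewrite -scaler_prod; apply: eq_bigr => j _; rewrite -det_map_mx.
rewrite [in RHS]/zminor rmorph_prod /=.
set Z := (X in _ *: \det X).
have -> : map_mx (gl_act (diag_mx (\row_i x i)))
    (\matrix_(p, q) zvar F (T (enum_val p, j)) (enum_val q))
  = diag_mx (\row_p (x (T (enum_val p, j)))%:MP) *m Z.
  apply/matrixP => p q; rewrite mul_diag_mx !mxE [LHS]act_zvar.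
  by rewrite mul_mpolyC.
rewrite det_mulmx det_diag -mul_mpolyC rmorph_prod /=; congr (_ * _).
by apply: eq_bigr => p _; rewrite mxE mevalXU.
Qed.

Let act_Wmod x u : Wmod u -> Wmod (act x u).
Proof.
move=> [[c uE] [q qE]]; split.
  exists (fun T => c T * (weight T).@[x]); rewrite uE /act /gl_act raddf_sum /=.
  apply: eq_bigr => T _.
  by rewrite comp_mpolyZ [X in _ *: X]act_Delta scalerA.
exists (fun i j => x i *: act x (q i j)).
rewrite [in LHS]qE /act /gl_act raddf_sum; apply: eq_bigr => i _ /=.
rewrite raddf_sum; apply: eq_bigr => j _ /=.
by rewrite rmorphM /= [X in _ * X]act_zvar -scalerAr -scalerAl.
Qed.

Lemma is_flagged_char_exists : exists ch, is_flagged_char (F := F) D ch.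
Proof.
have [//|A AB] := quot_basis_exists Wmod_lin Wmod0
  (S := schur_module D) (v := fun T => Delta F D T).
exists (\sum_(i < #|A|) weight (enum_val i)) => x _.
exists #|A|, (fun i => Delta F D (enum_val i)).
exists (diag_mx (\row_i (weight (enum_val i)).@[x])); split=> // [i|].
  rewrite (bigD1 i) //= big1 => [|j ji].
    by rewrite addr0 !mxE eqxx mulr1n [gl_act _ _]act_Delta subrr.
  by rewrite !mxE (negPf ji) mulr0n scale0r.
rewrite mxtrace_diag raddf_sum /=; apply: eq_bigr => i _.
by rewrite mxE.
Qed.

Lemma flagged_charP : is_flagged_char D (flagged_char F D).
Proof. exact: epsilon_spec is_flagged_char_exists. Qed.

Lemma is_flagged_char_eval ch ch' x : (forall i, x i != 0) ->
  is_flagged_char (F := F) D ch -> is_flagged_char D ch' -> ch.@[x] = ch'.@[x].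
Proof.
move=> x0 /(_ x x0) chx /(_ x x0).
exact: (is_quot_trace_uniq (W := Wmod) (g := act x)
          Wmod_lin Wmod0 (act_lin x) (@act_Wmod x) chx).
Qed.

End CharacterTheory.

Lemma is_flagged_char_uniq (F : numFieldType) n m (D : diagram n m)
    (ch ch' : {mpoly F[n]}) :
  is_flagged_char D ch -> is_flagged_char D ch' -> ch = ch'.
Proof.
by move=> h h'; apply: torus_mpoly_eq => x x0; apply: is_flagged_char_eval h h'.
Qed.

(* Main.v *)
(**
  Choose i < j and k < l with (j, k), (i, l) in D, (i, k) not in D and j - i
  minimal.  Minimality says that a column with a cell strictly between rows i
  and j also has a cell in row i, and %-avoidance gives (j, l) in D.  Let T be
  the filling that puts i in the cells (j, c) with (i, c) not in D, and r in
  every other cell of row r.  The weight of T distinguishes the polynomials.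

  Setting z_(a, b) to x_a if a <= b and to 0 otherwise kills the ideal I and
  maps every Delta_T' to a scalar times its weight; for T the scalar is the
  determinant of unitriangular matrices, so this weight occurs in the character.

  Kohnert moves never decrease the number of cells of a column above a given
  row.  A diagram U in KD(D) with the weight of T therefore has the same counts
  as the diagram obtained by moving the cells as in T.  Then (j, k) has left
  row j along the way whereas (j, l), to its right, never moved: impossible.
*)
Require Import Defs.
From mathcomp Require Import all_boot all_order all_algebra.
From mathcomp Require Import reals complex mpoly.

Local Open Scope ring_scope.

Import Order.TTheory GRing.Theory Num.Theory.

Section Proof.
Set Implicit Arguments.
Unset Strict Implicit.

Lemma sum_nat_eq_leq (I : finType) (f g : I -> nat) :
  (forall i, f i <= g i)%N -> (\sum_i g i = \sum_i f i)%N -> f =1 g.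
Proof.
move=> lefg eqfg i; have := leqif_sum (fun i (_ : xpredT i) => leqif_eq (lefg i)).
by case=> _; rewrite -eqfg eqxx => /esym/forallP/(_ i)/eqP.
Qed.

Lemma enum_val_ord_mono n (A : {set 'I_n}) (p q : 'I_#|A|) :
  (p < q)%N -> (enum_val p < enum_val q)%N.
Proof.
move=> ltpq; pose x0 := enum_val p.
rewrite !(enum_val_nth x0).
have sA : sorted (relpre val ltn) (enum A).
  rewrite {1}/enum_mem -enumT; apply: sorted_filter.
    by move=> ? ? ?; apply: ltn_trans.
  by rewrite -sorted_map val_enum_ord iota_ltn_sorted.
apply: (sorted_ltn_nth (leT := relpre val ltn)) => //; rewrite ?inE -?cardE //.
by move=> ? ? ?; apply: ltn_trans.
Qed.

(** * How Kohnert moves change the column counts *)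

Section Kohnert.
Variables n m : nat.
Implicit Types D U V : diagram n m.

Definition above U (r : nat) (c : 'I_m) : nat :=
  \sum_(s < n | (s < r)%N) ((s, c) \in U).

Lemma aboveS U (r : 'I_n) c : above U r.+1 c = (above U r c + ((r, c) \in U))%N.
Proof.
rewrite /above (bigD1 r) //= addnC; congr (_ + _)%N; apply: eq_bigl => s.
by rewrite ltnS ltn_neqAle andbC.
Qed.

Lemma above_le U c r s : (r <= s)%N -> (above U r c <= above U s c)%N.
Proof.
move=> lers; rewrite /above [in leqRHS](bigID (fun x : 'I_n => x < r)%N) /=.
apply: leq_trans (leq_addr _ _); rewrite leq_eqVlt; apply/orP; left; apply/eqP.
by apply: eq_bigl => x; case: ltnP => xr; rewrite ?andbF // (leq_trans xr).
Qed.

Lemma above_const U c r s : (r <= s)%N ->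
  (forall x : 'I_n, (r <= x < s)%N -> (x, c) \notin U) -> above U r c = above U s c.
Proof.
move=> lers Uc; rewrite /above [in RHS](bigID (fun x : 'I_n => x < r)%N) /=.
rewrite [X in (_ + X)%N]big1 ?addn0 => [|x /andP[xs rx]]; last first.
  by rewrite (negPf (Uc x _)) // leqNgt rx.
by apply: eq_bigl => x; case: (ltnP x r) => xr; rewrite ?andbF // (leq_trans xr).
Qed.

Lemma sum_above U r : (\sum_c above U r c = \sum_(s < n | (s < r)%N) wt U s)%N.
Proof.
rewrite exchange_big; apply: eq_bigr => s _ /=.
rewrite mnmE -sum1dep_card [RHS]big_mkcond /=.
by apply: eq_bigr => c _; case: ifP.
Qed.

(** Adding an indicator on each side avoids truncated subtraction: the counts of column [c] grow by
    one exactly for [r' < s <= r]. *)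
Lemma kohnert_move_above U V : kohnert_move U V ->
  exists (r : 'I_n) (c : 'I_m) (r' : 'I_n),
    [/\ (r' < r)%N, (forall c' : 'I_m, (c < c')%N -> (r, c') \notin U)
    & forall s d, (above V s d + ((d == c) && (r < s))
                   = above U s d + ((d == c) && (r' < s)))%N].
Proof.
move=> /existsP[r /existsP[c /existsP[r'
  /and5P[Ur /forallP Uc r'r Ur' /andP[_ /eqP ->]]]]].
exists r, c, r'; split=> // [c' cc'|s d]; first by have /implyP := Uc c'; apply.
have ind (x : 'I_n) : (((d == c) && (x < s))
     = \sum_(y < n | y < s) ((y, d) == (x, c)) :> nat)%N.
  have [->|dc] := eqVneq d c; last first.
    by rewrite big1 // => y _; rewrite xpair_eqE (negPf dc) andbF.
  have [xs|xs] := ltnP x s; last first.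
    rewrite big1 // => y ys; rewrite xpair_eqE eqxx andbT; case: eqP => // yx.
    by rewrite yx ltnNge xs in ys.
  rewrite (bigD1 x) //= eqxx big1 // => y /andP[_ yx].
  by rewrite xpair_eqE (negPf yx).
rewrite !ind /above -!big_split; apply: eq_bigr => y _ /=.
rewrite !inE; have [->|] := eqVneq (y, d) (r, c).
  by rewrite Ur xpair_eqE eqxx andbT -val_eqE /= gtn_eqF.
by have [->|] := eqVneq (y, d) (r', c); rewrite ?(negPf Ur') //= addnC.
Qed.

Lemma KD_above D U : U \in KD D -> forall r c, (above D r c <= above U r c)%N.
Proof.
rewrite inE => /connectP[p]; elim: p D => [|V p IHp] D /=; first by move=> _ ->.
case/andP=> /kohnert_move_above[r [c [r' [r'r _ DV]]]] /IHp{}IHp /IHp{}IHp s d.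
apply: leq_trans (IHp s d); have := DV s d.
case: (d == c) => /=; last by rewrite !addn0 => ->.
case: (ltnP r s) => [rs|_]; last by rewrite addn0 => ->; apply: leq_addr.
by rewrite (ltn_trans r'r rs) => /addIn ->.
Qed.

(* The counts force (j, l) to stay in place along the whole path, so (j, k) is
   never the rightmost cell of row j. *)
Lemma KD_blocked D U (j : 'I_n) (k l : 'I_m) : (k < l)%N -> U \in KD D ->
    (j, l) \in D -> above U j l = above D j l -> above U j.+1 l = above D j.+1 l ->
    above U j.+1 k = above D j.+1 k ->
  above U j k = above D j k.
Proof.
move=> kl; rewrite inE => /connectP[p].
elim: p D => [|V p IHp] D /=; first by move=> _ ->.
case/andP=> DV Vp Up Djl eq1 eq2 eq3.
have VU : U \in KD V by rewrite inE; apply/connectP; exists p.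
have DV' : V \in KD D by rewrite inE connect1.
(* Counts never decrease along the path, so one that agrees at both ends agrees at [V]. *)
have sandwich s c : above U s c = above D s c -> above V s c = above D s c.
  move=> eqUD; apply/eqP; rewrite eqn_leq -{1}eqUD.
  by rewrite (KD_above VU) (KD_above DV').
have eqV1 := sandwich _ _ eq1; have eqV2 := sandwich _ _ eq2.
have eqV3 := sandwich _ _ eq3.
have Vjl : (j, l) \in V.
  move: eqV2; rewrite !aboveS eqV1 Djl => /addnI; by case: (_ \in V).
rewrite (IHp V) ?eqV1 ?eqV2 ?eqV3 //.
have [r [c [r' [r'r Dr DVE]]]] := kohnert_move_above DV.
have := DVE j k; have := DVE j.+1 k; rewrite eqV3.
have [kc|_ _] := eqVneq k c; last by rewrite /= !addn0.
rewrite !ltnS /= => /addnI.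
(* By [eqV3], [r <= j] iff [r' <= j]. Hence the move stays above or below row [j] and leaves this
   count alone, or it starts in row [j], where [(j, l)] lies further right. *)
case: (ltngtP r j) => [rj _|_|rj _]; last first.
- by have := Dr l; rewrite -kc kl (val_inj rj) Djl => /(_ isT).
- case: (leqP r' j) => // jr' _; rewrite [(r' < j)%N]ltnNge (ltnW jr').
  by rewrite !addn0.
by rewrite (ltn_trans r'r rj) => /addIn.
Qed.

End Kohnert.

(** * Weights occurring in the flagged character *)

Section FlaggedCharacter.
Variables (F : numFieldType) (n m : nat) (D : diagram n m).
Local Notation filling := {ffun 'I_n * 'I_m -> 'I_n}.
Implicit Type T : filling.
Local Notation zpoly := {mpoly F[n * n]}.

Definition content T : 'X_{1..n} := (\sum_(d in D) U_(T d))%MM.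

(** Counterpart of [sum_above] for fillings. *)
Lemma sum_content T r :
  (\sum_(s < n | (s < r)%N) content T s
     = \sum_(c < m) \sum_(s < n | (s, c) \in D) (T (s, c) < r))%N.
Proof.
rewrite [RHS](exchange_big_dep xpredT) //= pair_big_dep /=.
under eq_bigr => s _ do rewrite mnm_sumE.
rewrite exchange_big; apply: eq_big => -[s c] //= _.
under eq_bigr => t _ do rewrite mnm1E.
have [Tr|Tr] := ltnP (T (s, c)) r.
  rewrite (bigD1 (T (s, c))) //= eqxx big1 // => t /andP[_ /negPf].
  by rewrite eq_sym => ->.
by rewrite big1 // => t tr; case: eqP => // Tt; rewrite Tt leqNgt tr in Tr.
Qed.

Lemma prod_mpolyX_content (y : 'I_n -> F) T :
  'X_[content T].@[y] = \prod_(d in D) y (T d).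
Proof. by rewrite -mprodXE rmorph_prod; apply: eq_bigr => d _; apply: mevalXU. Qed.

Lemma comp_zvar k (M : 'M[{mpoly F[k]}]_n) a b :
  zvar F a b \mPo [tuple mxvec M 0 t | t < n * n] = M a b.
Proof. by rewrite /zvar comp_mpolyXU -tnth_nth tnth_mktuple mxvecE. Qed.

(** Each row of a minor is scaled by [y] at its entry, and these factors leave the determinant.
    Serves both the torus action and [upper_spec]. *)
Lemma Delta_rmorph (S : comNzRingType) (f : {rmorphism zpoly -> S})
    (y : 'I_n -> S) (g : 'I_n -> 'I_n -> S) T :
    (forall a b, f (zvar F a b) = y a * g a b) ->
  f (Delta F D T) = \prod_(d in D) y (T d) *
    \prod_(j < m) \det (\matrix_(p < #|col_rows D j|, q < #|col_rows D j|)
                        g (T (enum_val p, j)) (enum_val q)).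
Proof.
move=> fE; have -> : \prod_(d in D) y (T d)
    = \prod_(j < m) \prod_(p < #|col_rows D j|) y (T (enum_val p, j)).
  under [RHS]eq_bigr => j _ do
    rewrite -(big_enum_val (A := mem (col_rows D j)) (fun i => y (T (i, j)))).
  rewrite (exchange_big_dep xpredT) //= pair_big_dep; apply: eq_big => -[i j] //=.
  by rewrite inE.
rewrite -big_split rmorph_prod; apply: eq_bigr => j _ /=.
rewrite -det_map_mx; set Z := (X in _ = _ * \det X).
have -> : map_mx f (\matrix_(p, q) zvar F (T (enum_val p, j)) (enum_val q))
  = diag_mx (\row_p y (T (enum_val p, j))) *m Z.
  by apply/matrixP => p q; rewrite mul_diag_mx !mxE fE.
by rewrite det_mulmx det_diag; congr (_ * _); apply: eq_bigr => p _; rewrite mxE.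
Qed.

Lemma gl_act_diag_Delta (x : 'I_n -> F) T :
  gl_act (diag_mx (\row_i x i)) (Delta F D T)
    = 'X_[content T].@[x] *: Delta F D T.
Proof.
rewrite /gl_act (Delta_rmorph (y := fun a => (x a)%:MP) (g := @zvar F n)).
  rewrite prod_mpolyX_content -mul_mpolyC rmorph_prod; congr (_ * _).
move=> a b; rewrite [LHS]comp_zvar mxE mul_mpolyC (bigD1 a) //= big1 ?addr0.
  by rewrite !mxE eqxx.
by move=> i /negPf ia; rewrite !mxE ia scale0r.
Qed.

Let W (p : zpoly) := schur_module D p /\ lower_ideal p.

Lemma lower_part0 : W 0.
Proof.
split; first by exists (fun=> 0); rewrite big1 // => T _; rewrite scale0r.
exists (fun _ _ => 0).
by rewrite big1 // => i _; rewrite big1 // => j _; rewrite mul0r.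
Qed.

Lemma lower_part_linear a u v : W u -> W v -> W (a *: u + v).
Proof.
move=> [[c ->] [q qE]] [[d ->] [r rE]]; split.
  exists (fun T => a * c T + d T); rewrite scaler_sumr -big_split.
  by apply: eq_bigr => T _ /=; rewrite scalerDl scalerA.
rewrite qE rE; exists (fun i j => a *: q i j + r i j).
rewrite scaler_sumr -big_split; apply: eq_bigr => i _ /=.
rewrite scaler_sumr -big_split; apply: eq_bigr => j _ /=.
by rewrite mulrDl scalerAl.
Qed.

(** Every [Delta] is a weight vector of the torus, so a basis of the quotient chosen among them
    diagonalizes the action. *)
Lemma flagged_char_content : exists2 A : {set filling},
  quot_basis (schur_module D) W (fun i : 'I_#|A| => Delta F D (enum_val i))
  & flagged_char F D = \sum_(T in A) 'X_[content T].
Proof.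
have [//|A AB] := quot_basis_exists lower_part_linear lower_part0
  (S := schur_module D) (v := fun T => Delta F D T).
exists A => //; apply: is_flagged_char_uniq (flagged_charP D) _ => x _.
exists #|A|, (fun i => Delta F D (enum_val i)).
exists (diag_mx (\row_i 'X_[content (enum_val i)].@[x])); split=> // [i|].
  rewrite gl_act_diag_Delta (bigD1 i) //= big1 => [|j ji].
    by rewrite addr0 !mxE eqxx mulr1n subrr; apply: lower_part0.
  by rewrite !mxE (negPf ji) mulr0n scale0r.
rewrite mxtrace_diag big_enum_val raddf_sum /=; apply: eq_bigr => i _.
by rewrite mxE.
Qed.

(* Setting z_(i, j) to x_i for i <= j and to 0 otherwise kills the ideal I and
   sends Delta_T to a multiple of its weight. *)
Definition upper_spec (p : zpoly) : {mpoly F[n]} :=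
  p \mPo [tuple mxvec (\matrix_(a, b) ('X_a * (a <= b)%N%:R)) 0 t | t < n * n].

Lemma upper_spec_lower p : lower_ideal p -> upper_spec p = 0.
Proof.
case=> q ->; rewrite /upper_spec raddf_sum big1 // => i _ /=.
rewrite raddf_sum big1 // => j ji /=.
by rewrite rmorphM /= comp_zvar mxE leqNgt ji !mulr0.
Qed.

Definition flag_const T : F := 
    \prod_(j < m) \det (\matrix_(p < #|col_rows D j|, q < #|col_rows D j|)
                        (T (enum_val p, j) <= enum_val q)%N%:R).

Lemma upper_spec_Delta T :
  upper_spec (Delta F D T) = flag_const T *: 'X_[content T].
Proof.
rewrite /upper_spec (Delta_rmorph (y := fun a => 'X_a)
   (g := fun a b => (a <= b)%N%:R)) => [|a b]; last by rewrite [LHS]comp_zvar mxE.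
rewrite mprodXE -mul_mpolyC mulrC /flag_const rmorph_prod; congr (_ * _).
apply: eq_bigr => j _ /=; rewrite -det_map_mx; congr (\det _).
by apply/matrixP => p q; rewrite !mxE rmorph_nat.
Qed.

(** The hypotheses put ones on the diagonal and zeros below it, so every matrix is upper
    unitriangular. *)
Lemma flag_const1 T :
    (forall r c, (r, c) \in D -> T (r, c) <= r)%N ->
    (forall r s c, (r, c) \in D -> (s, c) \in D -> s < r -> s < T (r, c))%N ->
  flag_const T = 1.
Proof.
move=> T_le T_gt; rewrite /flag_const big1 // => j _; rewrite -det_tr det_trig.
  rewrite big1 // => p _; rewrite !mxE T_le //.
  by have := enum_valP p; rewrite inE.
apply/is_trig_mxP => q p qp; rewrite !mxE leqNgt T_gt //.
- by have := enum_valP p; rewrite inE.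
- by have := enum_valP q; rewrite inE.
- exact: enum_val_ord_mono.
Qed.

Lemma flagged_char_coef_neq0 T : flag_const T != 0 ->
  (flagged_char F D)@_(content T) != 0.
Proof.
move=> T1; have [A [_ span _] ->] := flagged_char_content.
have [|c [_ /upper_spec_lower]] := span (Delta F D T).
  exists (fun T' => (T' == T)%:R); rewrite (bigD1 T) //= eqxx scale1r big1 ?addr0 //.
  by move=> T' /negPf->; rewrite scale0r.
rewrite /upper_spec raddfB [X in _ - X]raddf_sum => /subr0_eq /=.
move/(congr1 (mcoeff (content T))); rewrite [X in X@_ _]upper_spec_Delta.
rewrite mcoeffZ mcoeffX eqxx mulr1 => eqT.
(* Otherwise no term on the right of [eqT] has this weight, and [flag_const T] would be zero. *)
have [i ci] : exists i : 'I_#|A|, content (enum_val i) == content T.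
  apply/existsP; apply: contraNT T1; rewrite negb_exists => /forallP nT.
  rewrite eqT raddf_sum big1 // => i _ /=; rewrite comp_mpolyZ.
  by rewrite [X in _ *: X]upper_spec_Delta !mcoeffZ mcoeffX (negPf (nT i)) !mulr0.
rewrite raddf_sum /= (bigD1 (enum_val i)) ?enum_valP //= mcoeffX ci.
(* The coefficient counts basis fillings of this content, so nothing cancels. *)
rewrite lt0r_neq0 // ltr_wpDr ?ltr01 // sumr_ge0 // => T' _.
by rewrite mcoeffX ler0n.
Qed.

End FlaggedCharacter.

(** * Shortest violations of the northwest condition *)

Section NonNorthwest.
Variables (n m : nat) (D : diagram n m).

Definition nw_violation (i j : 'I_n) (k l : 'I_m) : bool :=
  [&& (i < j)%N, (k < l)%N, (j, k) \in D, (i, l) \in D & (i, k) \notin D].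

Lemma minimal_nw_violation : ~ northwest D -> exists i j k l,
  nw_violation i j k l /\
  forall i' j' k' l', nw_violation i' j' k' l' -> (j - i <= j' - i')%N.
Proof.
move=> nwD; pose bad (t : 'I_n * 'I_n * ('I_m * 'I_m)) :=
  nw_violation t.1.1 t.1.2 t.2.1 t.2.2.
have [t0 bad_t0 | nbad] := pickP bad; last first.
  case: nwD => i j k l ij kl Djk Dil; have := nbad ((i, j), (k, l)).
  by rewrite /bad /nw_violation /= ij kl Djk Dil; case: (_ \in D).
case: (arg_minnP (fun t : 'I_n * 'I_n * ('I_m * 'I_m) => t.1.2 - t.1.1)%N bad_t0).
move=> [[i j] [k l]] bad_t t_min; exists i, j, k, l; split=> // i' j' k' l' bad'.
exact: (t_min ((i', j'), (k', l'))).
Qed.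

(** If [c < l], the pair [(r, c)], [(i, l)] is too short to be a violation. Otherwise [(j, k)],
    [(r, c)] yields [(r, k)], and then [(r, k)], [(i, l)] yields [(i, k)], which is absurd. *)
Lemma between_minimal_violation i j k l (r : 'I_n) (c : 'I_m) :
    nw_violation i j k l ->
    (forall i' j' k' l', nw_violation i' j' k' l' -> (j - i <= j' - i')%N) ->
    (i < r < j)%N -> (r, c) \in D -> (i, c) \in D.
Proof.
move=> /and5P[ij kl Djk Dil Dik] ij_min /andP[ir rj] Drc.
have short (i' j' : 'I_n) (k' l' : 'I_m) :
      (j' - i' < j - i)%N -> (i' < j')%N -> (k' < l')%N ->
    (j', k') \in D -> (i', l') \in D -> (i', k') \in D.
  move=> lt_ij i'j' k'l' Djk' Dil'; apply: contraLR lt_ij => Dik'.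
  by rewrite -leqNgt; apply: (ij_min i' j' k' l'); apply/and5P.
have ri_ji : (r - i < j - i)%N by rewrite ltn_sub2r.
have jr_ji : (j - r < j - i)%N by rewrite ltn_sub2l.
have [cl|lc] := ltnP c l; first exact: short ri_ji ir cl Drc Dil.
have Drk := short _ _ _ _ jr_ji rj (leq_trans kl lc) Djk Drc.
by rewrite (short _ _ _ _ ri_ji ir kl Drk Dil) in Dik.
Qed.

Definition drop_filling (i j : 'I_n) : {ffun 'I_n * 'I_m -> 'I_n} :=
  [ffun d => if (d.1 == j) && ((i, d.2) \notin D) then i else d.1].

Section Gap.
Variables i j : 'I_n.
Hypothesis ij : (i < j)%N.
Hypothesis gap : forall (r : 'I_n) c, (i < r < j)%N -> (r, c) \in D -> (i, c) \in D.

Let moved c := ((j, c) \in D) && ((i, c) \notin D).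

Lemma flag_const_drop (F : numFieldType) : flag_const F D (drop_filling i j) = 1.
Proof.
apply: flag_const1 => [r c _|r s c Drc Dsc sr]; rewrite ffunE /=.
  by case: ifP => // /andP[/eqP-> _]; apply: ltnW.
case: eqP => // rj; case: ifPn => //= Dic; rewrite rj in sr.
(* A cell in row [s] with [i <= s < j] is impossible: [Dic] excludes [s = i], and [gap] excludes
   [i < s]. *)
rewrite ltn_neqAle; apply/andP; split.
  by apply: contraNneq Dic => /val_inj <-.
by rewrite leqNgt; apply: contraNN Dic => si; apply: (gap (r := s)); rewrite ?si.
Qed.

(** Lowering an entry from [j] to [i] creates one more entry smaller than [r] exactly when
    [i < r <= j]. *)
Lemma sum_content_drop r :
  (\sum_(s < n | (s < r)%N) content D (drop_filling i j) s
    = \sum_c (above D r c + (moved c && (i < r <= j))))%N.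
Proof.
rewrite sum_content; apply: eq_bigr => c _.
have aboveE : above D r c = (\sum_(s < n | (s, c) \in D) (s < r))%N.
  rewrite /above big_mkcond [RHS]big_mkcond; apply: eq_bigr => s _ /=.
  by do 2 case: ifP.
rewrite aboveE; have [mc|] := boolP (moved c); last first.
  rewrite /moved negb_and addn0 => nm; apply: eq_bigr => s Ds.
  rewrite ffunE /=; case: eqP => //= sj; rewrite -sj Ds /= in nm.
  by rewrite (negPf nm).
have /andP[Djc Dic] := mc.
rewrite (bigD1 j) //= [in RHS](bigD1 j) //= addnAC; congr (_ + _)%N.
  rewrite ffunE /= eqxx Dic /=; case: (ltnP j r) => jr.
    by rewrite (ltn_trans ij jr) andbF.
  by rewrite andbT.
by apply: eq_bigr => s /andP[_ /negPf sj]; rewrite ffunE /= sj.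
Qed.

(** * Column counts of a Kohnert diagram with the weight of the filling *)

Variable U : diagram n m.
Hypothesis KD_U : U \in KD D.
Hypothesis wt_U : wt U = content D (drop_filling i j).

Let le_DU := KD_above KD_U.

Let sum_above_U r :
  (\sum_c above U r c = \sum_c (above D r c + (moved c && (i < r <= j))))%N.
Proof. by rewrite sum_above wt_U sum_content_drop. Qed.

(** For such [r] the totals over all columns agree, and [KD_above] compares them column by
    column. *)
Let above_out r c : ~~ (i < r <= j)%N -> above U r c = above D r c.
Proof.
move=> rij; apply/esym; move: c; apply: sum_nat_eq_leq => [c|]; first exact: le_DU.
by rewrite sum_above_U; apply: eq_bigr => c _; rewrite (negPf rij) andbF addn0.
Qed.

(** As the totals agree, an upper bound in each column suffices. If [(i, d)] is in [D], row [i] is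
    already full there; if not, the count at [j.+1] is a bound, and by [gap] only [(j, d)] can add
    to it after row [i]. *)
Let above_i1 c : above U i.+1 c = (above D i.+1 c + moved c)%N.
Proof.
have le_c d : (above U i.+1 d <= above D i.+1 d + moved d)%N.
  have out r : (r <= i)%N || (j < r)%N -> above U r d = above D r d.
    by case/orP => h; apply: above_out; rewrite negb_and -leqNgt -ltnNge h ?orbT.
  have [Did|Did] := boolP ((i, d) \in D).
    apply: leq_trans (leq_addr _ _); rewrite !aboveS out ?leqnn // Did.
    by rewrite leq_add2l leq_b1.
  apply: leq_trans (above_le U d (_ : i < j.+1)%N) _; first exact: ltnW.
  rewrite out ?ltnSn ?orbT // aboveS /moved Did andbT leq_add2r.
  rewrite (@above_const _ _ D d i.+1 j) // => r rij.
  by apply: contraNN Did; apply: gap.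
move: c; apply: sum_nat_eq_leq le_c _; rewrite sum_above_U.
by apply: eq_bigr => c _; rewrite ltnSn ij !andbT.
Qed.

(** Here lower bounds suffice: in a moved column [gap] keeps the count of [D] constant from [i.+1]
    to [j], so the gain at [i.+1] persists. *)
Let above_j c : above U j c = (above D j c + moved c)%N.
Proof.
apply/esym; move: c; apply: sum_nat_eq_leq => [c|]; last first.
  by rewrite sum_above_U; apply: eq_bigr => c _; rewrite ij leqnn !andbT.
have [mc|] := boolP (moved c); last by rewrite addn0 le_DU.
have /andP[_ Dic] := mc.
rewrite -(@above_const _ _ D c i.+1 j) // => [|r rij]; last first.
  by apply: contraNN Dic; apply: gap.
by have := above_i1 c; rewrite mc /= => <-; apply: above_le.
Qed.

Lemma drop_contra (k l : 'I_m) : (k < l)%N -> (j, k) \in D -> (i, k) \notin D ->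
  (j, l) \in D -> (i, l) \in D -> False.
Proof.
move=> kl Djk Dik Djl Dil.
have out c : above U j.+1 c = above D j.+1 c by apply: above_out; rewrite ltnn andbF.
have := KD_blocked kl KD_U Djl.
(* Above row [j], column [l] keeps its count while column [k] gains a cell, which [KD_blocked]
   forbids. *)
rewrite !out !above_j /moved Dil Djk Dik andbF addn0 /=.
by move=> /(_ erefl erefl erefl) /eqP; rewrite -[eqbRHS]addn0 eqn_add2l.
Qed.

End Gap.

Lemma flagged_char_neq_kohnert (F : numFieldType) :
  percent_avoiding D -> ~ northwest D -> flagged_char F D <> kohnert_poly F D.
Proof.
move=> pD /minimal_nw_violation[i [j [k [l [bad bad_min]]]]] chK.
have gap (r : 'I_n) (c : 'I_m) : (i < r < j)%N -> (r, c) \in D -> (i, c) \in D.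
  exact: between_minimal_violation bad bad_min.
have /and5P[ij kl Djk Dil Dik] := bad.
have [Dik'|Djl] := pD _ _ _ _ ij kl Djk Dil; first by rewrite Dik' in Dik.
have := flagged_char_coef_neq0 (F := F) (D := D) (T := drop_filling i j).
rewrite flag_const_drop // oner_neq0 chK raddf_sum => /(_ isT) /=.
(* No diagram in [KD D] has this weight, so the coefficient vanishes on the Kohnert side. *)
rewrite big1 ?eqxx // => U UD; rewrite mcoeffX; case: eqP => // wU.
by case: (drop_contra ij gap UD wU kl Djk Dik Djl Dil).
Qed.

End NonNorthwest.

End Proof.

Theorem theorem4p15 (R : realType) (n m : nat) (D : {set 'I_n * 'I_m}) :
  percent_avoiding D -> ~ northwest D ->
  flagged_char R[i] D <> kohnert_poly R[i] D.
Proof. exact: flagged_char_neq_kohnert. Qed.
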